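(* Let $d\ge2$, let $u\in\mathbb{S}^{d-1}$, and let $X$ be a random vector in $\mathbb{R}^d$ whose distribution has no atom and whose support is not concentrated on any line. Assume $\mathbb{E}\|X\|^3<\infty$, and let $\mu=\mathbb{E}X$ and $\Sigma$ be the mean vector and covariance matrix of $X$. For $0<\alpha<1$ let $q_X(\alpha u)$ be the geometric quantile of $X$ with index vector $\alpha u$. Then, as $\alpha\to1$, $$\|q_X(\alpha u)\|\Big[\|q_X(\alpha u)\|^2(1-\alpha)-\tfrac12\big(\operatorname{tr}\Sigma-\langle\Sigma u,u\rangle\big)\Big]\longrightarrow \mathbb{E}\Big(\langle X,u\rangle\,\big\|X-\langle X,u\rangle u\big\|^2\Big)-\Big\langle(2\Sigma+\mu\mu^{\top})u,\ (I-uu^{\top})\mu\Big\rangle .$$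
   Context: $\mathbb{S}^{d-1}$ is the Euclidean unit sphere in $\mathbb{R}^d$; $\|\cdot\|$ and $\langle\cdot,\cdot\rangle$ are the Euclidean norm and inner product; $I$ is the $d\times d$ identity matrix. Geometric quantile: for an $\mathbb{R}^d$-valued random vector $X$ ($d>1$) whose distribution is not supported on any line, $u\in\mathbb{S}^{d-1}$ and $0\le\alpha<1$, the geometric quantile $q_X(\alpha u)$ is the (existing and unique) minimiser $$q_X(\alpha u)=\operatorname*{arg\,min}_{q\in\mathbb{R}^d}\Big(\mathbb{E}\big[\|X-q\|-\|X\|\big]-\langle\alpha u,q\rangle\Big).$$ *)

(* Defs.v *)
From mathcomp Require Export all_boot all_order all_algebra.
From mathcomp Require Export all_classical all_reals all_analysis.
Export Order.TTheory GRing.Theory Num.Theory.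
Export numFieldNormedType.Exports.

Set Implicit Arguments.
Unset Strict Implicit.
Unset Printing Implicit Defensive.

Local Open Scope classical_set_scope.
Local Open Scope ring_scope.

(* The library norm [`|x|] on matrices is the sup norm, hence [enorm]. *)
Definition dot (R : realType) (d : nat) (x y : 'cV[R]_d) : R :=
  \sum_(i < d) x i 0 * y i 0.

Definition enorm (R : realType) (d : nat) (x : 'cV[R]_d) : R :=
  Num.sqrt (dot x x).

Definition line (R : realType) (d : nat) (a v : 'cV[R]_d) : set 'cV[R]_d :=
  [set a + t *: v | t in [set: R]].

Section RandomVector.
Context (R : realType) (disp : measure_display) (T : measurableType disp).
Context (P : probability T R) (d : nat) (X : T -> 'cV[R]_d).

(* Coordinatewise measurability, i.e. measurability for the product
   sigma-algebra, which is the Borel sigma-algebra of R^d. *)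
Definition random_vector : Prop :=
  forall i, measurable_fun [set: T] (fun w => X w i 0).

Definition atomless : Prop := forall x, P (X @^-1` [set x]) = 0%E.

Definition on_a_line : Prop :=
  exists a v : 'cV[R]_d, v != 0 /\ P (X @^-1` line a v) = 1%E.

Definition mean_vector : 'cV[R]_d :=
  \col_i fine 'E_P[fun w => X w i 0].

Definition covariance_matrix : 'M[R]_d :=
  \matrix_(i, j) fine (covariance P (fun w => X w i 0) (fun w => X w j 0)).

Definition quantile_objective (v q : 'cV[R]_d) : \bar R :=
  ('E_P[fun w => (enorm (X w - q) - enorm (X w))%R] - (dot v q)%:E)%E.

Definition is_geometric_quantile (v q : 'cV[R]_d) : Prop :=
  forall q', (quantile_objective v q <= quantile_objective v q')%E.

(* The value is the junk 0 when no minimiser exists. *)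
Definition geometric_quantile (v : 'cV[R]_d) : 'cV[R]_d :=
  xget 0 [set q | is_geometric_quantile v q].

End RandomVector.

(* Main.v *)
(** First-order optimality reads E[(q - X)/|q - X|] = alpha u: atomlessness
    allows differentiation under the expectation. A minimiser for index u itself
    would force X onto a line, so |q| tends to infinity as alpha tends to 1.

    Write r = |q|, D = |q - X|, c = <q - X, u>, and let p be the component of
    q - E X orthogonal to u. Testing optimality against u gives
    1 - alpha = E[1 - c/D], and D^2 - c^2 is the squared length of the
    orthogonal component of q - X, with expectation
    tr Sigma - <Sigma u, u> + |p|^2. Testing against p, and using
    |r - D| <= |X|, gives |p| = O(1/r), so the term (r/2) |p|^2 vanishes. What
    remains is the expectation of r^3 (1 - c/D) - (r/2) (D^2 - c^2), which
    converges pointwise to <X, u> |(X - E X) orthogonal to u|^2 and is dominated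
    by a multiple of (C + |X|)^3. The domination holds near the singularity
    D = 0 because |X| is then comparable to r. *)

Require Import Defs.
From mathcomp Require Import measurable_realfun.
From mathcomp Require Import ring lra.

Set Implicit Arguments.
Unset Strict Implicit.
Unset Printing Implicit Defensive.

Local Open Scope classical_set_scope.
Local Open Scope ring_scope.

(** * Euclidean geometry and real-valued integrals *)

Section EuclideanSpace.
Context (R : realType) (d : nat).
Implicit Types (x y z u : 'cV[R]_d) (t : R).

Lemma dotC x y : dot x y = dot y x.
Proof. by apply: eq_bigr => i _; rewrite mulrC. Qed.

Lemma dotDl x y z : dot (x + y) z = dot x z + dot y z.
Proof. by rewrite -big_split; apply: eq_bigr => i _; rewrite mxE mulrDl. Qed.

Lemma dotZl t x z : dot (t *: x) z = t * dot x z.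
Proof. by rewrite mulr_sumr; apply: eq_bigr => i _; rewrite mxE mulrA. Qed.

Lemma dotNl x z : dot (- x) z = - dot x z.
Proof. by rewrite -scaleN1r dotZl mulN1r. Qed.

Lemma dotBl x y z : dot (x - y) z = dot x z - dot y z.
Proof. by rewrite dotDl dotNl. Qed.

Lemma dotDr x y z : dot z (x + y) = dot z x + dot z y.
Proof. by rewrite !(dotC z) dotDl. Qed.

Lemma dotZr t x z : dot z (t *: x) = t * dot z x.
Proof. by rewrite !(dotC z) dotZl. Qed.

Lemma dotNr x z : dot z (- x) = - dot z x.
Proof. by rewrite !(dotC z) dotNl. Qed.

Lemma dotBr x y z : dot z (x - y) = dot z x - dot z y.
Proof. by rewrite dotDr dotNr. Qed.

Lemma dot0l z : dot 0 z = 0.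
Proof. by rewrite -(scale0r (0 : 'cV[R]_d)) dotZl mul0r. Qed.

Definition dotE := (dotDl, dotDr, dotZl, dotZr, dotNl, dotNr).

Lemma dot_ge0 x : 0 <= dot x x.
Proof. by apply: sumr_ge0 => i _; rewrite -expr2 sqr_ge0. Qed.

Lemma dot_eq0 x : dot x x = 0 -> x = 0.
Proof.
move=> x0; apply/colP => i; rewrite mxE; apply/eqP; rewrite -sqrf_eq0 expr2.
apply/eqP; move: i isT.
by apply: psumr_eq0P => // i _; rewrite -expr2 sqr_ge0.
Qed.

Lemma enorm_ge0 x : 0 <= enorm x.
Proof. exact: sqrtr_ge0. Qed.

Lemma sqr_enorm x : enorm x ^+ 2 = dot x x.
Proof. by rewrite sqr_sqrtr ?dot_ge0. Qed.

Lemma enorm0 : enorm (0 : 'cV[R]_d) = 0.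
Proof. by rewrite /enorm dot0l sqrtr0. Qed.

Lemma enorm_eq0 x : enorm x = 0 -> x = 0.
Proof. by move=> x0; apply: dot_eq0; rewrite -sqr_enorm x0 expr0n. Qed.

Lemma enormN x : enorm (- x) = enorm x.
Proof. by rewrite /enorm dotNl dotNr opprK. Qed.

Lemma sqr_enormD x y :
  enorm (x + y) ^+ 2 = enorm x ^+ 2 + 2 * dot x y + enorm y ^+ 2.
Proof. by rewrite !sqr_enorm !dotE (dotC y x); ring. Qed.

Lemma enorm_subC x y : enorm (x - y) = enorm (y - x).
Proof. by rewrite -enormN opprB. Qed.

Lemma enormZ t x : enorm (t *: x) = `|t| * enorm x.
Proof.
by rewrite /enorm dotZl dotZr mulrA -expr2 sqrtrM ?sqr_ge0// sqrtr_sqr.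
Qed.

Lemma cauchy_schwarz x y : `|dot x y| <= enorm x * enorm y.
Proof.
have [y0|y0] := eqVneq (dot y y) 0.
  by rewrite (dot_eq0 y0) dotC dot0l normr0 mulr_ge0 ?enorm_ge0.
have yp : 0 < dot y y by rewrite lt_neqAle eq_sym y0 dot_ge0.
rewrite -ler_sqr ?nnegrE ?mulr_ge0 ?enorm_ge0// exprMn !sqr_enorm real_normK ?num_real//.
(* The vector is [dot y y] times the component of [x] orthogonal to [y]. Its squared length is
   [dot y y] times the Cauchy-Schwarz gap, and the positive factor cancels. *)
have := dot_ge0 (dot y y *: x - dot x y *: y).
rewrite !dotE (dotC y x) => h.
rewrite -subr_ge0 -(pmulr_rge0 _ yp); move: h; congr (0 <= _); ring.
Qed.

Lemma dot_le_enorm x y : dot x y <= enorm x * enorm y.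
Proof. exact: le_trans (ler_norm _) (cauchy_schwarz x y). Qed.

Lemma ler_enormD x y : enorm (x + y) <= enorm x + enorm y.
Proof.
rewrite -ler_sqr ?nnegrE ?addr_ge0 ?enorm_ge0// sqr_enorm !dotE (dotC y x).
have := dot_le_enorm x y; have := sqr_enorm x; have := sqr_enorm y; nra.
Qed.

Lemma ler_enormB x y : enorm (x - y) <= enorm x + enorm y.
Proof. by rewrite -(enormN y) ler_enormD. Qed.

Lemma ler_dist_enorm x y : `|enorm x - enorm y| <= enorm (x - y).
Proof.
have := ler_enormD (x - y) y; have := ler_enormD (y - x) x.
rewrite !subrK (enorm_subC y x) ler_norml; lra.
Qed.

Lemma normr_coord_le_enorm x i : `|x i 0| <= enorm x.
Proof.
rewrite -sqrtr_sqr ler_wsqrtr// /dot (bigD1 i)//= -expr2 lerDl.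
by apply: sumr_ge0 => j _; rewrite -expr2 sqr_ge0.
Qed.

Lemma enorm_le_sum x : enorm x <= \sum_i `|x i 0|.
Proof.
have s0 : 0 <= \sum_i `|x i 0| by apply: sumr_ge0.
rewrite -ler_sqr ?nnegrE ?enorm_ge0// sqr_enorm expr2 mulr_suml.
apply: ler_sum => i _; rewrite (le_trans (ler_norm _))// normrM ler_wpM2l//.
by rewrite (bigD1 i)//= lerDl sumr_ge0.
Qed.

Lemma dot_mx1 i x : dot x (delta_mx i 0) = x i 0.
Proof.
rewrite /dot (bigD1 i)//= mxE !eqxx mulr1 big1 ?addr0// => j ji.
by rewrite mxE (negbTE ji) mulr0.
Qed.

(** For a unit vector [u], the orthogonal projection onto the hyperplane orthogonal to [u]. *)
Definition perp u x := x - dot x u *: u.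

Lemma perpB u x y : perp u (x - y) = perp u x - perp u y.
Proof. by apply/colP => i; rewrite !mxE dotBl; ring. Qed.

Lemma dot_perp u x : enorm u = 1 -> dot (perp u x) u = 0.
Proof. by move=> u1; rewrite !dotE -sqr_enorm u1; ring. Qed.

Lemma dot_perpl u x z : dot z u = 0 -> dot (perp u x) z = dot x z.
Proof. by move=> zu; rewrite !dotE (dotC u) zu; ring. Qed.

Lemma sqr_enorm_perp u x : enorm u = 1 ->
  enorm (perp u x) ^+ 2 = enorm x ^+ 2 - dot x u ^+ 2.
Proof.
move=> u1; rewrite !sqr_enorm !dotE (dotC u x) -(sqr_enorm u) u1; ring.
Qed.

Lemma enorm_perp_le u x : enorm u = 1 -> enorm (perp u x) <= enorm x.
Proof.
move=> u1; rewrite -ler_sqr ?nnegrE ?enorm_ge0// sqr_enorm_perp//.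
by rewrite lerBlDr lerDl sqr_ge0.
Qed.

End EuclideanSpace.

(** * Dominated convergence, measurability and vanishing integrals *)

Section RealIntegrals.
Context (R : realType) (disp : measure_display) (T : measurableType disp).
Context (P : probability T R).

Lemma Rintegral_cvg_dominated (f_ : nat -> T -> R) (f g : T -> R) :
  (forall n, measurable_fun setT (f_ n)) -> measurable_fun setT f ->
  P.-integrable setT (EFin \o g) ->
  {ae P, forall w, f_ n w @[n --> \oo] --> f w} ->
  (forall n w, `|f_ n w| <= g w) ->
  \int[P]_w f_ n w @[n --> \oo] --> \int[P]_w f w.
Proof.
move=> mf_ mf ig cf domf.
have mf_e n : measurable_fun setT (EFin \o f_ n) by exact/measurable_EFinP.
have mfe : measurable_fun setT (EFin \o f) by exact/measurable_EFinP.
have cfe : {ae P, forall w, [set: T] w ->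
    (EFin \o f_ n) w @[n --> \oo] --> (EFin \o f) w}.
  apply: filterS cf => w fw _; apply: cvg_EFin; [exact: nearW|exact: fw].
have domfe : {ae P, forall w n, [set: T] w ->
    (`|(EFin \o f_ n) w| <= (EFin \o g) w)%E}.
  by apply: aeW => w n _; rewrite /= lee_fin domf.
have [intf _ cvgf] := dominated_convergence measurableT mf_e mfe cfe ig domfe.
apply: fine_cvg; rewrite fineK//; exact: integrable_fin_num.
Qed.

Lemma Rintegral_cst_prob (c : R) : \int[P]_w c = c.
Proof.
by rewrite Rintegral_cst//= [X in fine X](_ : _ = 1%E) ?mulr1//; exact: probability_setT.
Qed.

Lemma fine_expectation (f : T -> R) : fine 'E_P[f] = \int[P]_w f w.
Proof. by rewrite unlock. Qed.

Lemma expectation_EFin (f : T -> R) : P.-integrable setT (EFin \o f) ->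
  'E_P[f]%E = (\int[P]_w f w)%:E.
Proof. by move=> fi; rewrite unlock fineK//; exact: integrable_fin_num. Qed.

(** On nonnegative reals the inverse is the power with exponent -1, also at 0, where both
    conventions give 0; powers are measurable. *)
Lemma measurable_funV_ge0 (f : T -> R) : (forall w, 0 <= f w) ->
  measurable_fun setT f -> measurable_fun setT (fun w => (f w)^-1).
Proof.
move=> f0 mf; rewrite (_ : (fun w => _) = (@powR R ^~ (-1)) \o f); last first.
  by apply/funext => w /=; rewrite powR_inv1.
by apply: measurableT_comp => //; exact: measurable_powR.
Qed.

Lemma measurable_fun_sqrt (f : T -> R) : (forall w, 0 <= f w) ->
  measurable_fun setT f -> measurable_fun setT (fun w => Num.sqrt (f w)).
Proof.
move=> f0 mf; rewrite (_ : (fun w => _) = (@powR R ^~ 2^-1) \o f); last first.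
  by apply/funext => w /=; rewrite powR12_sqrt.
by apply: measurableT_comp => //; exact: measurable_powR.
Qed.

Lemma measurable_zero_set (f : T -> R) : measurable_fun setT f ->
  measurable [set w | f w = 0].
Proof.
move=> mf; rewrite (_ : mkset _ = setT `&` f @^-1` [set 0]).
  exact: mf.
by apply/seteqP; split => w /=; [|case].
Qed.

Lemma Rintegral_eq0_prob (f : T -> R) : (forall w, 0 <= f w) ->
  P.-integrable setT (EFin \o f) -> \int[P]_w f w = 0 ->
  P [set w | f w = 0] = 1%E.
Proof.
move=> f0 fi int0; have mf : measurable_fun setT f.
  by apply/measurable_EFinP; case/integrableP: fi.
have mA := measurable_zero_set mf.
have : (\int[P]_w `|(EFin \o f) w| = 0)%E.
  under eq_integral => w _ do rewrite /= ger0_norm//.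
  rewrite -[LHS]fineK ?[fine _]int0//; exact: integrable_fin_num.
move/(ae_eq_integral_abs _ measurableT (measurable_int _ fi)) => [N [mN N0 sub]].
have cA : ~` [set w | f w = 0] `<=` N.
  by move=> w /= fw; apply: sub => /= h; apply: fw; exact: (EFin_inj (h I)).
rewrite -(setCK [set w | f w = 0]) probability_setC; last exact: measurableC.
rewrite (_ : P (~` _) = 0%E) ?sube0//.
apply/eqP; rewrite eq_le measure_ge0 andbT -N0.
by apply: le_measure; rewrite ?inE//; exact: measurableC.
Qed.

End RealIntegrals.

(** * Measurability of inner products, norms and projections *)

Section RandomVectors.
Context (R : realType) (disp : measure_display) (T : measurableType disp).
Context (P : probability T R) (d : nat).
Implicit Types X Y : T -> 'cV[R]_d.

Lemma random_vectorB q X : random_vector X -> random_vector (fun w => q - X w).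
Proof.
move=> mX i; under eq_fun do rewrite !mxE.
by apply: measurable_funB => //; exact: mX.
Qed.

Lemma measurable_dot X Y : random_vector X -> random_vector Y ->
  measurable_fun setT (fun w => dot (X w) (Y w)).
Proof.
by move=> mX mY; apply: measurable_sum => i; apply: measurable_funM;
  [exact: mX|exact: mY].
Qed.

Lemma measurable_dotl X z : random_vector X ->
  measurable_fun setT (fun w => dot (X w) z).
Proof. by move=> mX; apply: measurable_dot => // i; exact: measurable_cst. Qed.

Lemma measurable_enorm X : random_vector X ->
  measurable_fun setT (fun w => enorm (X w)).
Proof.
move=> mX; apply: measurable_fun_sqrt => [w|]; first exact: dot_ge0.
exact: measurable_dot.
Qed.

Lemma random_vector_perp u X : random_vector X ->
  random_vector (fun w => perp u (X w)).
Proof.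
move=> mX i; under eq_fun do rewrite !mxE.
apply: measurable_funB; first exact: mX.
by apply: measurable_funM => //; exact: measurable_dotl.
Qed.

End RandomVectors.

(** * Geometric quantiles *)

Section BoxMinimum.
Context (R : realType) (d : nat).

(** The Lipschitz bound gives continuity and the box is compact, so the extreme value theorem
    applies. The box is treated as a set of row vectors, hence the transposes. *)
Lemma lipschitz_box_min (g : 'cV[R]_d -> R) (K M : R) :
  (forall q q', `|g q - g q'| <= K * enorm (q - q')) -> 0 <= M ->
  exists2 c : 'cV[R]_d, (forall i, `|c i 0| <= M) &
    forall q : 'cV[R]_d, (forall i, `|q i 0| <= M) -> g c <= g q.
Proof.
move=> glip M0.
pose A := [set v : 'rV[R]_d | forall i, `[-M, M]%classic (v ord0 i)].
have cA : compact A.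
  apply: (@rV_compact _ _ (fun=> `[-M, M]%classic)) => i; exact: segment_compact.
have A0 : A !=set0.
  by exists 0 => i; rewrite /= mxE in_itv/= lerNl oppr0 M0.
have K0 : 0 <= `|K| by [].
have cg : {within A, continuous (fun v : 'rV[R]_d => g v^T)}.
  apply: continuous_subspaceT => v.
  rewrite /prop_for /continuous_at; apply/(@cvgrPdist_lt _ _ _ (nbhs v)) => e e0.
  (* A sup-norm distance below [e'] gives a Euclidean distance of at most [d * e']; the added 1
     keeps the denominator positive when [K] or [d] is 0. *)
  pose e' := e / (`|K| * d%:R + 1).
  have Kd0 : 0 < `|K| * d%:R + 1 by rewrite ltr_wpDl// mulr_ge0.
  have e'0 : 0 < e' by rewrite divr_gt0.
  apply: (filterS _ (nbhsx_ballx v e' e'0)) => y vy.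
  apply: le_lt_trans (glip _ _) _.
  apply: (@le_lt_trans _ _ (`|K| * (d%:R * e'))).
    apply: (@le_trans _ _ (`|K| * enorm (v^T - y^T))).
      by rewrite ler_wpM2r ?enorm_ge0// ler_norm.
    rewrite ler_wpM2l//; apply: le_trans (enorm_le_sum _) _.
    rewrite mulr_natl -[d in leRHS]card_ord -sumr_const.
    apply: ler_sum => i _; rewrite !mxE; apply/ltW.
    by case: vy => _ /(_ ord0 i).
  rewrite mulrA /e' mulrA -ltr_pdivlMr; last by rewrite invr_gt0.
  by rewrite invrK mulrC ltr_pM2l// ltrDl.
have [c cin cmin] := compact_EVT_min A0 cA cg.
exists c^T => [i|q qM].
  by move: cin; rewrite inE => /(_ i)/=; rewrite in_itv/= mxE -ler_norml.
rewrite -[q]trmxK; apply: cmin; rewrite inE => i /=.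
by rewrite in_itv/= mxE -ler_norml.
Qed.

End BoxMinimum.

(** * First-order condition, existence and divergence of quantiles *)

Section GeometricQuantile.
Context (R : realType) (disp : measure_display) (T : measurableType disp).
Context (P : probability T R) (d : nat) (X : T -> 'cV[R]_d).
Hypothesis mX : random_vector X.

Lemma integrable_EFinB (f g : T -> R) :
  P.-integrable setT (EFin \o f) -> P.-integrable setT (EFin \o g) ->
  P.-integrable setT (EFin \o (fun w => f w - g w)).
Proof. by move=> fi gi; exact: (integrableB measurableT fi gi). Qed.

Lemma integrable_le (f g : T -> R) : measurable_fun setT f ->
  P.-integrable setT (EFin \o g) -> (forall w, `|f w| <= g w) ->
  P.-integrable setT (EFin \o f).
Proof.
move=> mf ig fg; apply: (le_integrable measurableT _ _ ig).
  exact/measurable_EFinP.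
by move=> w _ /=; rewrite lee_fin (le_trans (fg w))// ler_norm.
Qed.

Lemma integrable_bounded (f : T -> R) (K : R) : measurable_fun setT f ->
  (forall w, `|f w| <= K) -> P.-integrable setT (EFin \o f).
Proof.
move=> mf fK; apply: (integrable_le mf _ fK).
exact: finite_measure_integrable_cst.
Qed.

Lemma measurable_direction (q z : 'cV[R]_d) :
  measurable_fun setT (fun w => dot (q - X w) z / enorm (q - X w)).
Proof.
have mqX : random_vector (fun w => q - X w) by exact: random_vectorB.
apply: measurable_funM; first exact: measurable_dotl.
apply: measurable_funV_ge0 => [w|]; first exact: enorm_ge0.
exact: measurable_enorm.
Qed.

Lemma direction_le (a z : 'cV[R]_d) : `|dot a z / enorm a| <= enorm z.
Proof.
(* At [a = 0] the quotient is 0, since [0^-1 = 0]. *)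
have [a0|a0] := eqVneq (enorm a) 0.
  by rewrite a0 invr0 mulr0 normr0 enorm_ge0.
have ap : 0 < enorm a by rewrite lt_neqAle eq_sym a0 enorm_ge0.
rewrite normrM normfV (gtr0_norm ap) ler_pdivrMr// mulrC.
exact: cauchy_schwarz.
Qed.

Lemma integrable_direction (q z : 'cV[R]_d) :
  P.-integrable setT
    (EFin \o (fun w => dot (q - X w) z / enorm (q - X w))).
Proof.
apply: integrable_bounded (measurable_direction q z) _ => w.
exact: direction_le.
Qed.

Lemma measurable_loss q :
  measurable_fun setT (fun w => enorm (X w - q) - enorm (X w)).
Proof.
apply: measurable_funB; last exact: measurable_enorm.
under eq_fun do rewrite enorm_subC.
by apply: measurable_enorm; exact: random_vectorB.
Qed.

Lemma integrable_loss q :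
  P.-integrable setT (EFin \o (fun w => enorm (X w - q) - enorm (X w))).
Proof.
apply: (integrable_bounded (measurable_loss q) (K := enorm q)) => w.
by apply: le_trans (ler_dist_enorm _ _) _; rewrite addrAC subrr add0r enormN.
Qed.

(** The loss is bounded by [enorm q], hence integrable, so the extended-real objective reduces to
    the real function [G q - dot v q]. *)
Let G q := \int[P]_w (enorm (X w - q) - enorm (X w)).

Lemma quantile_objectiveE v q :
  quantile_objective P X v q = (G q - dot v q)%:E.
Proof.
by rewrite /quantile_objective expectation_EFin//; exact: integrable_loss.
Qed.

Lemma geometric_quantileP v q : is_geometric_quantile P X v q <->
  forall q', G q - dot v q <= G q' - dot v q'.
Proof.
by split => h q'; have := h q'; rewrite !quantile_objectiveE lee_fin.
Qed.

Lemma loss_sub q q' :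
  G q - G q' = \int[P]_w (enorm (X w - q) - enorm (X w - q')).
Proof.
rewrite -RintegralB//; [|exact: integrable_loss..].
by apply: eq_Rintegral => w _; rewrite opprB addrA subrK.
Qed.

Lemma measurable_loss_sub q q' :
  measurable_fun setT (fun w => enorm (X w - q) - enorm (X w - q')).
Proof.
under eq_fun do rewrite enorm_subC (enorm_subC _ q').
by apply: measurable_funB; apply: measurable_enorm; exact: random_vectorB.
Qed.

Lemma loss_sub_le q q' w :
  `|enorm (X w - q) - enorm (X w - q')| <= enorm (q - q').
Proof.
apply: le_trans (ler_dist_enorm _ _) _.
by rewrite opprB addrC addrA subrK enorm_subC.
Qed.

Lemma loss_lipschitz q q' : `|G q - G q'| <= enorm (q - q').
Proof.
have mf := measurable_loss_sub q q'.
have fi := integrable_bounded mf (loss_sub_le q q').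
rewrite loss_sub; apply: le_trans (le_normr_Rintegral _ fi) _ => //.
rewrite -[leRHS](Rintegral_cst_prob P); apply: le_Rintegral => //.
- apply: (integrable_bounded (K := enorm (q - q'))) => [|w].
    exact: measurableT_comp.
  by rewrite normr_id loss_sub_le.
- exact: finite_measure_integrable_cst.
- by move=> w _; exact: loss_sub_le.
Qed.

(** Directional derivative of the norm away from 0. With [t = 1/(n+1)], multiplying by the conjugate
    [enorm (a + t *: z) + enorm a] turns the quotient into [2 * dot a z + t * enorm z ^+ 2] over
    that sum, which tends to [2 * enorm a], a nonzero limit. *)
Lemma difference_quotient_cvg (a z : 'cV[R]_d) : a != 0 ->
  n.+1%:R * (enorm (a + n.+1%:R^-1 *: z) - enorm a) @[n --> \oo] -->
    dot a z / enorm a.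
Proof.
move=> a0; have ap : 0 < enorm a.
  rewrite lt_neqAle enorm_ge0 andbT eq_sym.
  by apply: contraNneq a0 => /enorm_eq0 ->.
have t0 : @harmonic R @ \oo --> 0 by exact: cvg_harmonic.
have normc : enorm (a + n.+1%:R^-1 *: z) @[n --> \oo] --> enorm a.
  apply/subr_cvg0; apply/norm_cvg0P.
  apply: (@squeeze_cvgr _ _ _ _ (cst 0) (fun n => harmonic n * enorm z)).
  - apply: nearW => n; rewrite normr_ge0/=.
    apply: le_trans (ler_dist_enorm _ _) _.
    by rewrite addrAC subrr add0r enormZ ger0_norm.
  - exact: cvg_cst.
  - by rewrite -(mul0r (enorm z)); apply: cvgM => //; exact: cvg_cst.
have -> : (fun n => n.+1%:R * (enorm (a + n.+1%:R^-1 *: z) - enorm a)) =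
    (fun n => (2 * dot a z + harmonic n * enorm z ^+ 2) /
              (enorm (a + n.+1%:R^-1 *: z) + enorm a)).
  apply/funext => n.
  have Dp : enorm (a + n.+1%:R^-1 *: z) + enorm a != 0.
    by rewrite gt_eqF// ltr_wpDl ?enorm_ge0.
  apply: (mulIf Dp); rewrite divfK// -mulrA -subr_sqr !sqr_enorm !dotE.
  rewrite (dotC z a) /harmonic/=.
  have : n.+1%:R != 0 :> R by rewrite pnatr_eq0.
  by move: (n.+1%:R : R) => t tn0; field.
have -> : dot a z / enorm a =
    (2 * dot a z + 0 * enorm z ^+ 2) / (enorm a + enorm a).
  by rewrite mul0r addr0 -mulr2n -[enorm a *+ 2]mulr_natl -mulf_div divff ?mul1r ?pnatr_eq0.
apply: cvgM.
  by apply: cvgD; [exact: cvg_cst|apply: cvgM => //; exact: cvg_cst].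
apply: cvgV; first by rewrite gt_eqF// addr_gt0.
by apply: cvgD => //; exact: cvg_cst.
Qed.

Hypothesis hatom : atomless P X.

Lemma ae_neq q : {ae P, forall w, q - X w != 0}.
Proof.
exists (X @^-1` [set q]); split; last 2 first.
- exact: hatom.
- by move=> w /= /negP; rewrite negbK subr_eq0 => /eqP ->.
have -> : X @^-1` [set q] = [set w | enorm (q - X w) = 0].
  apply/seteqP; split => w /= => [->|/enorm_eq0/eqP].
    by rewrite subrr enorm0.
  by rewrite subr_eq0 => /eqP.
by apply: measurable_zero_set; apply: measurable_enorm; exact: random_vectorB.
Qed.

(** Minimality bounds the difference quotients of [G] in any direction [y] from below by [dot v y].
    They are dominated by [enorm y] and converge off the null event [X = q], so the bound passes to
    the derivative; the directions [z] and [- z] together give equality. *)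
Lemma quantile_first_order v q z : is_geometric_quantile P X v q ->
  \int[P]_w (dot (q - X w) z / enorm (q - X w)) = dot v z.
Proof.
move=> /geometric_quantileP qmin.
suff half y : dot v y <= \int[P]_w (dot (q - X w) y / enorm (q - X w)).
  apply/eqP; rewrite eq_le half andbT -lerN2 -dotNr.
  apply: le_trans (half _) _; rewrite le_eqVlt; apply/orP; left; apply/eqP.
  rewrite -mulN1r -RintegralZl//; last exact: integrable_direction.
  by apply: eq_Rintegral => w _; rewrite dotNr mulN1r mulNr.
pose f_ n w := n.+1%:R * (enorm (X w - (q + n.+1%:R^-1 *: y)) - enorm (X w - q)).
have f_E n w : f_ n w = n.+1%:R *
    (enorm ((q - X w) + n.+1%:R^-1 *: y) - enorm (q - X w)).
  by rewrite /f_ enorm_subC (enorm_subC _ q) addrAC.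
have cvgf : \int[P]_w f_ n w @[n --> \oo] -->
    \int[P]_w (dot (q - X w) y / enorm (q - X w)).
  apply: (Rintegral_cvg_dominated (g := fun=> enorm y)).
  - move=> n; apply: measurable_funM => //; exact: measurable_loss_sub.
  - exact: measurable_direction.
  - exact: finite_measure_integrable_cst.
  - apply: filterS (ae_neq q) => w qw.
    under eq_fun do rewrite f_E; exact: difference_quotient_cvg.
  - move=> n w; rewrite normrM ger0_norm// mulrC -ler_pdivlMr ?ltr0Sn//.
    apply: le_trans (loss_sub_le _ _ _) _.
    by rewrite addrAC subrr add0r enormZ ger0_norm ?invr_ge0// mulrC.
apply: (cvgr_to_ge cvgf); apply: nearW => n.
rewrite RintegralZl//; last first.
  apply: integrable_bounded (measurable_loss_sub _ _) (loss_sub_le _ _).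
rewrite -loss_sub -ler_pdivrMl ?ltr0Sn//.
have := qmin (q + n.+1%:R^-1 *: y); rewrite dotDr dotZr.
by move: (n.+1%:R^-1 * dot v y) => r; lra.
Qed.

Hypothesis intX : P.-integrable setT (EFin \o (fun w => enorm (X w))).

(** Integrates [enorm q <= enorm (X w) + enorm (X w - q)]. Growth with slope 1 makes the objective
    coercive for every index of norm below 1. *)
Lemma loss_ge q : enorm q - 2 * \int[P]_w enorm (X w) <= G q.
Proof.
have i2 : P.-integrable setT (EFin \o (fun w => 2 * enorm (X w))).
  by apply: (integrableZl measurableT 2 intX).
rewrite -RintegralZl// -[enorm q](Rintegral_cst_prob P) -RintegralB//; last first.
  exact: finite_measure_integrable_cst.
apply: le_Rintegral => //; last first.
  move=> w _; have := ler_enormB (X w) (X w - q).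
  by rewrite opprB addrCA subrr addr0; lra.
- exact: integrable_loss.
- apply: integrable_EFinB i2.
  exact: finite_measure_integrable_cst.
Qed.

Lemma tilted_lipschitz v q q' :
  `|(G q - dot v q) - (G q' - dot v q')| <= (1 + enorm v) * enorm (q - q').
Proof.
rewrite [X in `|X|](_ : _ = (G q - G q') - dot v (q - q')).
  apply: le_trans (ler_normB _ _) _; rewrite mulrDl mul1r lerD//.
    exact: loss_lipschitz.
  exact: cauchy_schwarz.
by rewrite dotBr; ring.
Qed.

Lemma loss0 : G 0 = 0.
Proof.
rewrite /G -[RHS](Rintegral_cst_prob P); apply: eq_Rintegral => w _.
by rewrite subr0 subrr.
Qed.

Lemma quantile_exists v : enorm v < 1 -> exists q, is_geometric_quantile P X v q.
Proof.
move=> v1; pose m1 := \int[P]_w enorm (X w).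
have m0 : 0 <= m1 by apply: Rintegral_ge0 => w _; exact: enorm_ge0.
(* Beyond this radius the lower bound [(1 - enorm v) * enorm q - 2 * m1] is positive, so the
   objective exceeds its value 0 at the origin, which lies in the box. *)
pose M := 2 * m1 / (1 - enorm v).
have v1' : 0 < 1 - enorm v by rewrite subr_gt0.
have M0 : 0 <= M by rewrite divr_ge0 ?mulr_ge0// ltW.
have [c cM cmin] := lipschitz_box_min (tilted_lipschitz v) M0.
exists c; apply/geometric_quantileP => q.
have [qM|/existsNP[i /negP]] := pselect (forall i, `|q i 0| <= M).
  exact: cmin.
rewrite -ltNge => qi.
have := cmin 0; rewrite (dotC v 0) dot0l loss0 subr0 => h.
apply: le_trans (h _) _ => [j|]; first by rewrite mxE normr0.
have Mq : M < enorm q by apply: lt_le_trans qi (normr_coord_le_enorm _ _).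
have := Mq; rewrite /M ltr_pdivrMr// => Mq'.
have := loss_ge q; have := dot_le_enorm v q; rewrite -/m1; nra.
Qed.

(** Testing optimality against [u] gives mean 0 to the nonnegative variable 1 minus the cosine of
    the angle between [q - X] and [u]. The cosine is then almost surely 1, which puts [X] on the
    line through [q] directed by [u]. *)
Lemma quantile_unit_on_a_line u q : enorm u = 1 ->
  is_geometric_quantile P X u q -> on_a_line P X.
Proof.
move=> u1 /quantile_first_order => /(_ u); rewrite -sqr_enorm u1 expr1n => fo.
pose g w := 1 - dot (q - X w) u / enorm (q - X w).
have ig : P.-integrable setT (EFin \o g).
  apply: integrable_EFinB; last exact: integrable_direction.
  exact: finite_measure_integrable_cst.
have dle w : dot (q - X w) u / enorm (q - X w) <= 1.
  by rewrite -u1 (le_trans (ler_norm _))// direction_le.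
have g0 : P [set w | g w = 0] = 1%E.
  apply: Rintegral_eq0_prob ig _ => [w|]; first by rewrite subr_ge0.
  rewrite RintegralB//; last 2 first.
  - exact: finite_measure_integrable_cst.
  - exact: integrable_direction.
  by rewrite Rintegral_cst_prob fo subrr.
exists q, u; split.
  by apply/eqP => u0; move: u1; rewrite u0 enorm0 => /eqP; rewrite eq_sym oner_eq0.
(* Describing the line as the zero set of a measurable function makes the event measurable. *)
have lineE : X @^-1` line q u = [set w | enorm (perp u (q - X w)) = 0].
  apply/seteqP; split => w /=.
    move=> [t _ <-]; rewrite opprD addrA subrr add0r /perp dotNl dotZl.
    by rewrite -sqr_enorm u1 expr1n mulr1 scaleNr opprK addNr enorm0.
  move=> /enorm_eq0 /eqP; rewrite subr_eq0 => /eqP e.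
  exists (- dot (q - X w) u) => //.
  by rewrite scaleNr -e opprB addrC subrK.
have mline : measurable (X @^-1` line q u).
  rewrite lineE; apply: measurable_zero_set; apply: measurable_enorm.
  by apply: random_vector_perp; exact: random_vectorB.
apply/eqP; rewrite eq_le probability_le1//= -g0.
apply: le_measure; rewrite ?inE//.
  apply: measurable_zero_set; apply/measurable_EFinP.
  by case/integrableP: ig.
rewrite lineE => w /= /eqP; rewrite subr_eq0 => /eqP e.
apply/eqP; rewrite -sqrf_eq0 sqr_enorm_perp// subr_eq0; apply/eqP.
(* A quotient equal to 1 excludes [X w = q], where it would be 0 by convention. *)
congr (_ ^+ 2); have n0 : enorm (q - X w) != 0.
  by apply/eqP => n0; move: e; rewrite n0 invr0 mulr0 => /eqP; rewrite oner_eq0.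
by apply: (mulIf (invr_neq0 n0)); rewrite -e divff.
Qed.

Hypothesis hline : ~ on_a_line P X.

(* The objective at index [u] has no global minimiser, so its minimum over a
   box exceeds some other value by a gap [delta > 0]. The objective at
   [alpha u] differs from it by [(1 - alpha) * dot u q], which is too small to
   close the gap when [alpha] is near 1. *)
Lemma quantile_unbounded u (M : R) : enorm u = 1 -> 0 <= M ->
  exists2 e : R, 0 < e & forall alpha q, 1 - e < alpha < 1 ->
    is_geometric_quantile P X (alpha *: u) q -> M < enorm q.
Proof.
move=> u1 M0.
have [c cM cmin] := lipschitz_box_min (tilted_lipschitz u) M0.
have [q' q'c] : exists q', G q' - dot u q' < G c - dot u c.
  apply: contrapT => /forallNP h; apply: hline.
  apply: (@quantile_unit_on_a_line u c) => //; apply/geometric_quantileP => q'.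
  by rewrite leNgt; apply/negP; exact: h.
pose delta := (G c - dot u c) - (G q' - dot u q').
have delta0 : 0 < delta by rewrite subr_gt0.
have D0 : 0 < enorm q' + M + 1.
  by rewrite ltr_wpDl// addr_ge0 ?enorm_ge0.
(* If [enorm q <= M], the two minimality inequalities give [delta <= (1 - alpha) * (enorm q' + M)],
   which this choice contradicts; the added 1 keeps the denominator positive. *)
exists (delta / (enorm q' + M + 1)); first by rewrite divr_gt0.
move=> alpha q /andP[ae a1] /geometric_quantileP /(_ q').
rewrite ltNge => qmin; apply/negP => qM.
have := cmin q (fun i => le_trans (normr_coord_le_enorm q i) qM).
move: qmin; rewrite !dotZl.
have : (1 - alpha) * (enorm q' + M + 1) < delta by rewrite -ltr_pdivlMr//; lra.
have := cauchy_schwarz u q; have := cauchy_schwarz u q'.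
rewrite u1 !mul1r !ler_norml => /andP[_ h1] /andP[h2 _].
rewrite /delta; nra.
Qed.

End GeometricQuantile.

(** * Moments *)

Section PolynomialGrowth.
Context (R : realType) (disp : measure_display) (T : measurableType disp).
Context (P : probability T R) (d : nat) (X : T -> 'cV[R]_d).
Hypothesis mX : random_vector X.

(** Reduces integrability to counting degrees: the classes are stable under sums and products, and a
    third moment covers degrees up to 3. The base [1 + enorm (X w)] is at least 1, so the classes
    increase with [k]. *)
Definition growth (k : nat) (f : T -> R) := measurable_fun setT f /\
  exists2 K : R, 0 <= K & forall w, `|f w| <= K * (1 + enorm (X w)) ^+ k.

Lemma growth_weaken k l f : (k <= l)%N -> growth k f -> growth l f.
Proof.
move=> kl [mf [K K0 fK]]; split=> //; exists K => // w.
apply: le_trans (fK w) _; rewrite ler_wpM2l// ler_weXn2l//.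
by rewrite lerDl enorm_ge0.
Qed.

Lemma growth_cst c : growth 0 (fun=> c).
Proof. by split=> //; exists `|c| => // w; rewrite mulr1. Qed.

Lemma growthM k l f g : growth k f -> growth l g ->
  growth (k + l) (fun w => f w * g w).
Proof.
move=> [mf [K K0 fK]] [mg [L L0 gL]]; split; first exact: measurable_funM.
exists (K * L) => [|w]; first exact: mulr_ge0.
by rewrite exprD mulrACA normrM ler_pM.
Qed.

Lemma growthD k f g : growth k f -> growth k g -> growth k (fun w => f w + g w).
Proof.
move=> [mf [K K0 fK]] [mg [L L0 gL]]; split; first exact: measurable_funD.
exists (K + L) => [|w]; first exact: addr_ge0.
by rewrite mulrDl (le_trans (ler_normD _ _))// lerD.
Qed.

Lemma growthZ c k f : growth k f -> growth k (fun w => c * f w).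
Proof. exact: growthM (growth_cst c). Qed.

Lemma growthN k f : growth k f -> growth k (fun w => - f w).
Proof. by move=> /(growthZ (-1)); under eq_fun do rewrite mulN1r. Qed.

Lemma growthB k f g : growth k f -> growth k g -> growth k (fun w => f w - g w).
Proof. by move=> gf /growthN; exact: growthD. Qed.

Lemma growthX k n f : growth k f -> growth (k * n) (fun w => f w ^+ n).
Proof.
move=> gf; elim: n => [|n ih].
  by rewrite muln0; under eq_fun do rewrite expr0; exact: growth_cst.
by rewrite mulnS; under eq_fun do rewrite exprS; exact: growthM.
Qed.

Lemma growth_enorm : growth 1 (fun w => enorm (X w)).
Proof.
split; first exact: measurable_enorm.
by exists 1 => // w; rewrite mul1r ger0_norm ?enorm_ge0// expr1 lerDr.
Qed.

Lemma growth_enormB v : growth 1 (fun w => enorm (X w - v)).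
Proof.
split.
  under eq_fun do rewrite enorm_subC.
  by apply: measurable_enorm; exact: random_vectorB.
exists (1 + enorm v) => [|w]; first by rewrite addr_ge0 ?enorm_ge0.
rewrite ger0_norm ?enorm_ge0// expr1.
have := ler_enormB (X w) v; have := enorm_ge0 (X w); have := enorm_ge0 v; nra.
Qed.

Lemma growth_dot z : growth 1 (fun w => dot (X w) z).
Proof.
split; first exact: measurable_dotl.
exists (enorm z) => [|w]; first exact: enorm_ge0.
rewrite mulrC expr1; apply: le_trans (cauchy_schwarz _ _) _.
by rewrite ler_wpM2r ?enorm_ge0// lerDr.
Qed.

Lemma growth_coord i : growth 1 (fun w => X w i 0).
Proof. by under eq_fun do rewrite -dot_mx1; exact: growth_dot. Qed.

Hypothesis moment3 : P.-integrable setT (EFin \o (fun w => enorm (X w) ^+ 3)).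

Lemma growth_integrable k f : (k <= 3)%N -> growth k f ->
  P.-integrable setT (EFin \o f).
Proof.
move=> k3 /(growth_weaken k3)[mf [K K0 fK]].
(* From [(1 + s) ^+ 3 <= 4 * (s ^+ 3 + 1)], whose gap is [3 * (s - 1) ^+ 2 * (s + 1)]. The sum is
   written as a difference to fit [integrable_EFinB]. *)
have ig : P.-integrable setT
    (EFin \o (fun w => 4 * K * enorm (X w) ^+ 3 - - (4 * K))).
  apply: integrable_EFinB; last exact: finite_measure_integrable_cst.
  exact: (integrableZl measurableT (4 * K) moment3).
apply: (integrable_le mf ig) => w; apply: le_trans (fK w) _.
have := enorm_ge0 (X w); move: (enorm (X w)) => s s0.
have -> : 4 * K * s ^+ 3 - - (4 * K) = K * (4 * (s ^+ 3 + 1)) by ring.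
rewrite ler_wpM2l// -subr_ge0.
have -> : 4 * (s ^+ 3 + 1) - (1 + s) ^+ 3 = 3 * (s - 1) ^+ 2 * (s + 1) by ring.
by apply: mulr_ge0; [apply: mulr_ge0 => //; exact: sqr_ge0|exact: addr_ge0].
Qed.

End PolynomialGrowth.

(** * Mean, covariance and the third-order constant *)

Section Moments.
Context (R : realType) (disp : measure_display) (T : measurableType disp).
Context (P : probability T R) (d : nat) (X : T -> 'cV[R]_d).
Hypothesis mX : random_vector X.
Hypothesis moment3 : P.-integrable setT (EFin \o (fun w => enorm (X w) ^+ 3)).

Let mu := mean_vector P X.
Let Sigma := covariance_matrix P X.

Lemma Rintegral_sum (I : Type) (s : seq I) (f : I -> T -> R) :
  (forall i, P.-integrable setT (EFin \o f i)) ->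
  \int[P]_w (\sum_(i <- s) f i w) = \sum_(i <- s) \int[P]_w f i w.
Proof.
move=> fi; elim: s => [|i s ih].
  by rewrite big_nil; under eq_Rintegral do rewrite big_nil; rewrite Rintegral_cst_prob.
rewrite big_cons -ih; under eq_Rintegral do rewrite big_cons.
apply: RintegralD => //.
have := @integrable_sum _ _ _ P _ measurableT _ s xpredT
  (fun i => EFin \o f i) (fun i _ => fi i).
by apply: eq_integrable => // w _ /=; rewrite sumEFin.
Qed.

Lemma dot_mean z : dot mu z = \int[P]_w dot (X w) z.
Proof.
rewrite Rintegral_sum => [|i].
  apply: eq_bigr => i _; rewrite mxE fine_expectation -RintegralZr//.
  exact: growth_integrable (growth_coord mX i).
have gi : growth X 1 (fun w => X w i 0 * z i 0).
  by under eq_fun do rewrite mulrC; apply: growthZ; exact: growth_coord.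
exact: growth_integrable gi.
Qed.

Let Y w := X w - mu.

Lemma growth_centered z : growth X 1 (fun w => dot (Y w) z).
Proof.
under eq_fun do rewrite dotBl; apply: growthB; first exact: growth_dot.
by apply: growth_weaken (growth_cst _ _).
Qed.

Lemma Rintegral_centered z : \int[P]_w dot (Y w) z = 0.
Proof.
under eq_Rintegral do rewrite dotBl.
rewrite RintegralB//; last 2 first.
- exact: growth_integrable (growth_dot mX z).
- exact: finite_measure_integrable_cst.
by rewrite Rintegral_cst_prob dot_mean subrr.
Qed.

Lemma covarianceE_Rintegral i j : Sigma i j = \int[P]_w (Y w i 0 * Y w j 0).
Proof.
rewrite mxE covariance.unlock fine_expectation.
by apply: eq_Rintegral => w _; rewrite !mxE.
Qed.

Lemma growth_centered_coord i : growth X 1 (fun w => Y w i 0).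
Proof. by under eq_fun do rewrite -dot_mx1; exact: growth_centered. Qed.

Lemma growth_cov i j : growth X 2 (fun w => Y w i 0 * Y w j 0).
Proof.
exact: (growthM (growth_centered_coord i) (growth_centered_coord j)).
Qed.

Lemma trace_covariance : \tr Sigma = \int[P]_w enorm (Y w) ^+ 2.
Proof.
under eq_Rintegral do rewrite sqr_enorm.
rewrite Rintegral_sum => [|i]; last exact: growth_integrable (growth_cov i i).
by apply: eq_bigr => i _; rewrite covarianceE_Rintegral.
Qed.

Lemma dot_covariance a b :
  dot (Sigma *m a) b = \int[P]_w (dot (Y w) a * dot (Y w) b).
Proof.
transitivity (\int[P]_w \sum_i \sum_j (a j 0 * b i 0 * (Y w i 0 * Y w j 0))).
  have gr i j : growth X 2 (fun w => a j 0 * b i 0 * (Y w i 0 * Y w j 0)).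
    by apply: growthZ; exact: growth_cov.
  rewrite Rintegral_sum => [|i]; last first.
    suff gi : growth X 2
        (fun w => \sum_j (a j 0 * b i 0 * (Y w i 0 * Y w j 0))).
      exact: growth_integrable gi.
    split; first by apply: measurable_sum => j; have [] := gr i j.
    elim: (index_enum _) => [|j s [K K0 hK]].
      by exists 0 => // w; rewrite big_nil normr0 mul0r.
    have [_ [L L0 hL]] := gr i j; exists (L + K) => [|w]; first exact: addr_ge0.
    by rewrite big_cons mulrDl (le_trans (ler_normD _ _))// lerD.
  apply: eq_bigr => i _; rewrite Rintegral_sum => [|j]; last first.
    exact: growth_integrable (gr i j).
  rewrite mxE mulr_suml; apply: eq_bigr => j _.
  rewrite RintegralZl//; last exact: growth_integrable (growth_cov i j).
  by rewrite -covarianceE_Rintegral; ring.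
apply: eq_Rintegral => w _; rewrite mulrC mulr_suml; apply: eq_bigr => i _.
by rewrite mulr_sumr; apply: eq_bigr => j _; ring.
Qed.

Variable u : 'cV[R]_d.
Hypothesis u1 : enorm u = 1.

Lemma growth_sqr_perp v : growth X 2 (fun w => enorm (perp u (X w - v)) ^+ 2).
Proof.
under eq_fun do rewrite sqr_enorm_perp// dotBl.
apply: growthB; first exact: (growthX 2 (growth_enormB mX v)).
apply: (growthX 2 (k := 1)); apply: growthB; first exact: growth_dot.
exact: growth_weaken (growth_cst _ _).
Qed.

(** Pythagoras for the unit vector [u], integrated: the leading constant is the total variance of
    [X] in the hyperplane orthogonal to [u]. *)
Lemma covariance_perp :
  \tr Sigma - dot (Sigma *m u) u = \int[P]_w enorm (perp u (Y w)) ^+ 2.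
Proof.
have gc := growth_sqr_perp mu.
have gu : growth X 2 (fun w => dot (Y w) u * dot (Y w) u).
  exact: (growthM (growth_centered u) (growth_centered u)).
rewrite trace_covariance dot_covariance -RintegralB//.
- by apply: eq_Rintegral => w _; rewrite sqr_enorm_perp// expr2.
- have := growthD gc gu; under eq_fun do rewrite sqr_enorm_perp// -expr2 subrK.
  exact: growth_integrable.
- exact: growth_integrable gu.
Qed.

(** Matches the stated limit with the one that the expansion produces. With [v = perp u mu],
    replacing [perp u (X w)] by [perp u (Y w)] costs the mean of [(dot (Y w) u + dot mu u) * (2 *
    dot (Y w) v + dot v v)]. Terms linear in [Y] integrate to 0; the quadratic term gives [Sigma],
    and the constant gives [mu *m mu^T] because [dot mu v = dot v v]. *)
Lemma third_moment_perp :
  \int[P]_w (dot (X w) u * enorm (perp u (X w)) ^+ 2)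
    - dot ((2 *: Sigma + mu *m mu^T) *m u) (perp u mu) =
  \int[P]_w (dot (X w) u * enorm (perp u (Y w)) ^+ 2).
Proof.
set v := perp u mu.
have vu : dot v u = 0 by exact: dot_perp.
have gY := growth_centered.
have gYuv : growth X 2 (fun w => dot (Y w) u * dot (Y w) v).
  exact: (growthM (gY u) (gY v)).
have mumu : (mu *m mu^T) *m u = dot mu u *: mu.
  rewrite -mulmxA; apply/colP => i; rewrite !mxE big_ord1 [LHS]mulrC !mxE; congr (_ * _).
  by apply: eq_bigr => j _; rewrite mxE.
rewrite mulmxDl -scalemxAl mumu dotDl !dotZl dot_covariance.
have -> : dot mu v = dot v v by rewrite -(dot_perpl mu vu).
have g3 a : growth X 3 (fun w => dot (X w) u * enorm (perp u (X w - a)) ^+ 2).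
  by apply: (growthM (growth_dot mX u)); exact: growth_sqr_perp.
have g30 : growth X 3 (fun w => dot (X w) u * enorm (perp u (X w)) ^+ 2).
  by have := g3 0; under eq_fun do rewrite subr0.
have gvv : growth X 1 (fun w => dot (Y w) v * (2 * dot mu u)).
  by under eq_fun do rewrite mulrC; apply: growthZ; exact: gY.
have gvu : growth X 1 (fun w => dot (Y w) u * dot v v).
  by under eq_fun do rewrite mulrC; apply: growthZ; exact: gY.
have g12 (f : T -> R) : growth X 1 f -> P.-integrable setT (EFin \o f).
  exact: growth_integrable.
have ic (c : R) : P.-integrable setT (EFin \o (fun=> c)).
  exact: finite_measure_integrable_cst.
apply/eqP; rewrite subr_eq addrC -subr_eq -RintegralB//; last 2 first.
- exact: growth_integrable g30.
- exact: growth_integrable (g3 mu).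
have -> : \int[P]_w (dot (X w) u * enorm (perp u (X w)) ^+ 2 -
      dot (X w) u * enorm (perp u (Y w)) ^+ 2) =
    \int[P]_w (2 * (dot (Y w) u * dot (Y w) v) + (dot (Y w) v * (2 * dot mu u)
      + (dot (Y w) u * dot v v + dot mu u * dot v v))).
  apply: eq_Rintegral => w _.
  have -> : perp u (X w) = perp u (Y w) + v by rewrite perpB subrK.
  have -> : dot (X w) u = dot (Y w) u + dot mu u by rewrite dotBl subrK.
  by rewrite sqr_enormD (dot_perpl _ vu) (sqr_enorm v); ring.
have i1 : P.-integrable setT (EFin \o (fun w => dot (Y w) u * dot (Y w) v)).
  exact: growth_integrable gYuv.
have i2 := growthZ 2 gYuv.
have i4 : growth X 1 (fun w => dot (Y w) u * dot v v + dot mu u * dot v v).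
  apply: growthD => //; exact: growth_weaken (growth_cst _ _).
have i3 := growthD gvv i4.
rewrite RintegralD//; [|exact: growth_integrable i2|exact: g12].
rewrite RintegralD//; [|exact: g12|exact: g12].
rewrite RintegralD//; last exact: g12.
rewrite RintegralZl// !RintegralZr//; [|exact/g12/gY|exact/g12/gY].
rewrite !Rintegral_centered Rintegral_cst_prob; apply/eqP; ring.
Qed.

End Moments.

(** * The remainder of the expansion *)

Section Remainder.
Context (R : realType).

(* [remainder r D c] is [r^3] times the gap [1 - cos] minus its leading term,
   where [D] is the length of a vector and [c] its component along [u]. *)
Definition remainder (r D c : R) : R :=
  r ^+ 3 * (1 - c / D) - r / 2 * (D ^+ 2 - c ^+ 2).

(** Here [s] stands for the norm of [X] and [b] for the length of the orthogonal component. For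
    [s <= r / 4] the two large terms cancel algebraically. Otherwise [r <= 4 * (C + s)], and each
    term is bounded separately, which covers the singularity [D = 0]. *)
Lemma remainder_le (r D c b s C : R) : 0 < r -> 0 <= D -> 0 <= b -> 0 <= s ->
  0 <= C -> b ^+ 2 = D ^+ 2 - c ^+ 2 -> `|D - r| <= s -> b <= C + s ->
  4 * C <= r -> (s <= r / 4 -> r / 4 <= c) ->
  `|remainder r D c| <= 130 * (C + s) ^+ 3.
Proof.
move=> r0 D0 b0 s0 C0 b2 Drs bC Cr cr; rewrite /remainder -b2.
have cD : `|c| <= D.
  rewrite -ler_sqr ?nnegrE// real_normK ?num_real//.
  by rewrite -subr_ge0 -b2 sqr_ge0.
have Cs0 : 0 <= C + s by rewrite addr_ge0.
have [sr|rs] := leP s (r / 4).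
  have {}cr := cr sr; move: Drs; rewrite ler_norml => /andP[Dr1 Dr2].
  have D1 : 3 / 4 * r <= D by lra.
  have Dp : 0 < D by apply: lt_le_trans D1; rewrite mulr_gt0.
  have cD' : c <= D by rewrite (le_trans (ler_norm _)).
  (* The gap [t] satisfies [t * (D + c) = b ^+ 2] with [D + c >= r], so it is at most both
     [b ^+ 2 / r] and [b]. The remainder equals [r / D * (t * k)], where [k] has order [r] instead
     of [r ^+ 2]. *)
  pose t := D - c; have t0 : 0 <= t by rewrite subr_ge0.
  have tE : t * (D + c) = b ^+ 2 by rewrite b2 /t; ring.
  have tr : t * r <= b ^+ 2 by rewrite -tE ler_wpM2l//; lra.
  have br : b <= r by lra.
  have tb : t <= b.
    rewrite -(ler_pM2r r0); apply: le_trans tr _.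
    by rewrite expr2 ler_wpM2l.
  pose k := r ^+ 2 - D * (D + c) / 2.
  have kE : k = (r - D) * (r + D) + D * t / 2 by rewrite /k /t; field.
  have kb : `|k| <= 3 * (r * s) + b ^+ 2 / 2.
    rewrite kE; apply: le_trans (ler_normD _ _) _; apply: lerD.
      rewrite normrM (distrC r) [`|r + D|]ger0_norm; last by rewrite addr_ge0// ltW.
      apply: (@le_trans _ _ (s * (3 * r))); last by lra.
      apply: ler_pM => //; first by rewrite addr_ge0// ltW.
        by rewrite ler_norml Dr1 Dr2.
      by lra.
    rewrite ger0_norm ?divr_ge0 ?mulr_ge0// ler_pM2r ?invr_gt0//.
    by rewrite -tE mulrC ler_wpM2l//; lra.
  have -> : r ^+ 3 * (1 - c / D) - r / 2 * b ^+ 2 = r / D * (t * k).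
    by rewrite -tE /k /t; field; rewrite gt_eqF.
  have rD : 0 <= r / D <= 2.
    apply/andP; split; first by rewrite divr_ge0// ltW.
    by rewrite ler_pdivrMr//; lra.
  case/andP: rD => rD0 rD2.
  rewrite (normrM (r / D)) (normrM t) (ger0_norm rD0) (ger0_norm t0).
  apply: (@le_trans _ _ (2 * (t * (3 * (r * s) + b ^+ 2 / 2)))).
    apply: ler_pM => //; first by rewrite mulr_ge0.
    by rewrite ler_wpM2l.
  have -> : 2 * (t * (3 * (r * s) + b ^+ 2 / 2)) =
      6 * (t * r * s) + t * b ^+ 2 by field.
  apply: (@le_trans _ _ (7 * (C + s) ^+ 3)).
    have b2s : b ^+ 2 <= (C + s) ^+ 2 by rewrite ler_pXn2r ?nnegrE.
    have -> : 7 * (C + s) ^+ 3 =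
      6 * ((C + s) ^+ 2 * (C + s)) + (C + s) * (C + s) ^+ 2 by ring.
    apply: lerD.
      rewrite ler_wpM2l//; apply: ler_pM => //.
      - by rewrite mulr_ge0// ltW.
      - exact: le_trans tr b2s.
      - by rewrite lerDr.
    by apply: ler_pM => //; [exact: sqr_ge0|exact: le_trans bC].
  by rewrite ler_wpM2r ?exprn_ge0//; lra.
have cD1 : `|c / D| <= 1.
  have [->|Dn0] := eqVneq D 0; first by rewrite invr0 mulr0 normr0.
  have Dp : 0 < D by rewrite lt_neqAle eq_sym Dn0.
  by rewrite normrM normfV (gtr0_norm Dp) ler_pdivrMr// mul1r.
have r4 : r <= 4 * (C + s) by lra.
have rC3 : r ^+ 3 <= 64 * (C + s) ^+ 3.
  apply: (@le_trans _ _ ((4 * (C + s)) ^+ 3)).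
    by rewrite ler_pXn2r ?nnegrE ?mulr_ge0// ltW.
  by rewrite exprMn; lra.
have b2s : b ^+ 2 <= (C + s) ^+ 2 by rewrite ler_pXn2r ?nnegrE.
apply: le_trans (ler_normB _ _) _.
(* The cubic term contributes 64 times 2, as [1 - c / D] is at most 2 in absolute value; the
   quadratic one contributes 2. *)
have -> : 130 * (C + s) ^+ 3 =
    64 * (C + s) ^+ 3 * 2 + 2 * (C + s) * (C + s) ^+ 2 by ring.
apply: lerD.
  rewrite normrM (ger0_norm (exprn_ge0 3 (ltW r0))); apply: ler_pM => //.
    by rewrite exprn_ge0// ltW.
  by apply: le_trans (ler_normB _ _) _; rewrite normr1; lra.
rewrite ger0_norm; last by apply: mulr_ge0; [rewrite divr_ge0// ltW|exact: sqr_ge0].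
apply: ler_pM; [by rewrite divr_ge0// ltW|exact: sqr_ge0|by lra|exact: b2s].
Qed.

(** Carries out the cancellation before any limit is taken: once [D ^+ 2 - c ^+ 2] is factored out,
    only ratios to [r] with finite limits remain. *)
Lemma remainderE (r D c g : R) : r != 0 -> D != 0 -> D + c != 0 ->
  r ^+ 2 - D ^+ 2 = g ->
  remainder r D c = (D ^+ 2 - c ^+ 2) *
    ((2 * (g / r) + (D ^+ 2 - c ^+ 2) / r * ((D / r) / (D / r + c / r)))
     / (2 * (D / r) * (D / r + c / r))).
Proof.
move=> r0 D0 Dc0 <-; rewrite /remainder.
have -> : D / r + c / r = (D + c) / r by rewrite mulrDl.
by field; rewrite r0 D0 Dc0.
Qed.

Lemma squeeze_cvg0 (f g : nat -> R) : (forall n, `|f n| <= g n) ->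
  g n @[n --> \oo] --> (0 : R) -> f n @[n --> \oo] --> (0 : R).
Proof.
move=> fg g0; apply/norm_cvg0P; apply: (squeeze_cvgr _ (cvg_cst 0) g0).
by apply: nearW => n; rewrite normr_ge0 fg.
Qed.

End Remainder.

(** * Pointwise limit of the remainder *)

Section RemainderLimit.
Context (R : realType) (d : nat) (u mu x : 'cV[R]_d) (q : nat -> 'cV[R]_d).
Hypothesis u1 : enorm u = 1.
Hypothesis q0 : forall n, 0 < enorm (q n).
Hypothesis qinv : (enorm (q n))^-1 @[n --> \oo] --> (0 : R).
Hypothesis qdir : dot (q n) u / enorm (q n) @[n --> \oo] --> (1 : R).
Hypothesis qperp : enorm (perp u (q n - mu)) @[n --> \oo] --> (0 : R).

Let cvgM0 (f : nat -> R) (a : R) : f n @[n --> \oo] --> a ->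
  f n / enorm (q n) @[n --> \oo] --> (0 : R).
Proof. by move=> fa; rewrite -(mulr0 a); exact: cvgM. Qed.

(** In [remainderE], [D / r] and [c / r] tend to 1, [g / r] tends to [2 * dot x u], and
    [D ^+ 2 - c ^+ 2] stays bounded, so the second factor tends to [4 * dot x u / 4]. *)
Lemma remainder_cvg :
  remainder (enorm (q n)) (enorm (q n - x)) (dot (q n - x) u)
    @[n --> \oo] --> dot x u * enorm (perp u (x - mu)) ^+ 2.
Proof.
have cstx : enorm x / enorm (q n) @[n --> \oo] --> (0 : R).
  exact: (cvgM0 (cvg_cst (enorm x))).
have Dr : enorm (q n - x) / enorm (q n) @[n --> \oo] --> (1 : R).
  apply/subr_cvg0; apply: (squeeze_cvg0 _ cstx) => n.
  rewrite -[X in _ - X](divff (lt0r_neq0 (q0 n))) -mulrBl normrM normfV.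
  rewrite (gtr0_norm (q0 n)) ler_pM2r ?invr_gt0//.
  apply: le_trans (ler_dist_enorm _ _) _.
  by rewrite addrAC subrr add0r enormN.
have cr : dot (q n - x) u / enorm (q n) @[n --> \oo] --> (1 : R).
  under eq_fun do rewrite dotBl mulrBl.
  have h := cvgB qdir (cvgM0 (cvg_cst (dot x u))).
  by rewrite subr0 in h; exact: h.
have B : enorm (q n - x) ^+ 2 - dot (q n - x) u ^+ 2 @[n --> \oo] -->
    enorm (perp u (x - mu)) ^+ 2.
  under eq_fun do rewrite -sqr_enorm_perp//.
  rewrite expr2; under eq_fun do rewrite expr2.
  suff h : enorm (perp u (q n - x)) @[n --> \oo] --> enorm (perp u (x - mu)).
    by apply: cvgM.
  apply/subr_cvg0; apply: (squeeze_cvg0 _ qperp) => n.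
  rewrite -(enormN (perp u (x - mu))); apply: le_trans (ler_dist_enorm _ _) _.
  by rewrite opprK !perpB addrA subrK.
(* Splits [q n] into its part along [u], the vanishing [perp u (q n - mu)] and the fixed
   [perp u mu]; only the first survives division by [enorm (q n)]. *)
have qx : dot (q n) x / enorm (q n) @[n --> \oo] --> dot x u.
  have -> : (fun n => dot (q n) x / enorm (q n)) = (fun n =>
      dot (q n) u / enorm (q n) * dot x u
      + dot (perp u (q n - mu)) x / enorm (q n)
      + dot (perp u mu) x / enorm (q n)).
    by apply/funext => n; rewrite perpB /perp !dotE (dotC u x); ring.
  have qpx : dot (perp u (q n - mu)) x @[n --> \oo] --> (0 : R).
    apply: (@squeeze_cvg0 _ _ (fun n => enorm (perp u (q n - mu)) * enorm x)).
      by move=> n; exact: cauchy_schwarz.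
    by rewrite -(mul0r (enorm x)); apply: cvgM => //; exact: cvg_cst.
  have h := cvgD (cvgD (cvgM qdir (cvg_cst (dot x u))) (cvgM0 qpx))
    (cvgM0 (cvg_cst (dot (perp u mu) x))).
  by rewrite mul1r !addr0 in h; exact: h.
have g : (2 * dot (q n) x - enorm x ^+ 2) / enorm (q n) @[n --> \oo] -->
    2 * dot x u - 0.
  under eq_fun do rewrite mulrBl -mulrA.
  apply: cvgB; last exact: (cvgM0 (cvg_cst _)).
  by apply: cvgM => //; exact: cvg_cst.
have S : enorm (q n - x) / enorm (q n) + dot (q n - x) u / enorm (q n)
    @[n --> \oo] --> (1 + 1 : R) by exact: cvgD.
have nz2 : (1 : R) + 1 != 0 by rewrite -mulr2n pnatr_eq0.
pose B_ n := enorm (q n - x) ^+ 2 - dot (q n - x) u ^+ 2.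
pose D_ n := enorm (q n - x) / enorm (q n).
pose S_ n := D_ n + dot (q n - x) u / enorm (q n).
pose g_ n := (2 * dot (q n) x - enorm x ^+ 2) / enorm (q n).
have lim : B_ n * ((2 * g_ n + B_ n / enorm (q n) * (D_ n / S_ n))
      / (2 * D_ n * S_ n)) @[n --> \oo] -->
    enorm (perp u (x - mu)) ^+ 2 *
      ((2 * (2 * dot x u - 0) + 0 * (1 / (1 + 1))) / (2 * 1 * (1 + 1))).
  apply: cvgM; first exact: B.
  apply: cvgM.
    apply: cvgD; first by apply: cvgM; [exact: cvg_cst|exact: g].
    apply: cvgM; first exact: (cvgM0 B).
    by apply: cvgM; [exact: Dr|exact: cvgV].
  apply: cvgV; first by rewrite !mulf_neq0// oner_neq0.
  by apply: cvgM => //; apply: cvgM => //; exact: cvg_cst.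
have -> : dot x u * enorm (perp u (x - mu)) ^+ 2 =
    enorm (perp u (x - mu)) ^+ 2 *
    ((2 * (2 * dot x u - 0) + 0 * (1 / (1 + 1))) / (2 * 1 * (1 + 1))).
  by field.
(* The nonvanishing conditions of [remainderE] hold only for large [n], so the two sequences are
   identified eventually. *)
apply: cvg_trans lim; apply: near_eq_cvg.
near=> n.
have Dr0 : 0 < enorm (q n - x) / enorm (q n).
  by near: n; apply: (cvgr_gt 1) => //; exact: ltr01.
have Sr0 : 0 < enorm (q n - x) / enorm (q n) + dot (q n - x) u / enorm (q n).
  by near: n; apply: (cvgr_gt (1 + 1)) => //; exact: addr_gt0.
rewrite /= (@remainderE _ _ _ _ (2 * dot (q n) x - enorm x ^+ 2))//.
- by rewrite lt0r_neq0.
- by apply: contraTneq Dr0 => ->; rewrite mul0r ltxx.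
- by apply: contraTneq Sr0; rewrite -mulrDl => ->; rewrite mul0r ltxx.
- by rewrite !sqr_enorm !dotE (dotC x (q n)); ring.
Unshelve. all: by end_near. Qed.

End RemainderLimit.

(** * Expansion of the quantile *)

Section Expansion.
Context (R : realType) (disp : measure_display) (T : measurableType disp).
Context (P : probability T R) (d : nat) (X : T -> 'cV[R]_d).
Hypothesis mX : random_vector X.
Hypothesis moment3 : P.-integrable setT (EFin \o (fun w => enorm (X w) ^+ 3)).
Variable u : 'cV[R]_d.
Hypothesis u1 : enorm u = 1.

Let mu := mean_vector P X.
Let m1 := \int[P]_w enorm (X w).
(** [C] bounds [perp u q] and the error of the approximation of [dot q u] by [enorm q * alpha]; [K]
    is the constant in the decay of [perp u (q - mu)]; [tau] is the variance computed in
    [covariance_perp]. *)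
Let C := m1 + enorm mu.
Let K := \int[P]_w (2 * ((C + enorm (X w)) * enorm (X w))).
Let tau := \int[P]_w enorm (perp u (X w - mu)) ^+ 2.

Let m1_ge0 : 0 <= m1.
Proof. by apply: Rintegral_ge0 => w _; exact: enorm_ge0. Qed.

Let C_ge0 : 0 <= C. Proof. by rewrite addr_ge0 ?enorm_ge0. Qed.

Let growthK : growth X 2 (fun w => 2 * ((C + enorm (X w)) * enorm (X w))).
Proof.
apply: growthZ; apply: (growthM (k := 1) (l := 1)); last exact: growth_enorm.
apply: growthD; last exact: growth_enorm.
exact: growth_weaken (growth_cst _ _).
Qed.

Section OneQuantile.
Variables (alpha : R) (q : 'cV[R]_d).
Hypothesis fo : forall z,
  \int[P]_w (dot (q - X w) z / enorm (q - X w)) = alpha * dot u z.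

Let r := enorm q.

(** By the first-order condition multiplied by [r], the left side is the mean of the direction term
    times [enorm (q - X w) - r], a factor that is at most [enorm (X w)] in absolute value. *)
Lemma radial_le z (g : T -> R) : P.-integrable setT (EFin \o g) ->
  (forall w, `|dot (q - X w) z / enorm (q - X w)| * enorm (X w) <= g w) ->
  `|dot (q - mu) z - r * (alpha * dot u z)| <= \int[P]_w g w.
Proof.
move=> ig gle.
have iX : P.-integrable setT (EFin \o (fun w => dot (q - X w) z)).
  suff gX : growth X 1 (fun w => dot (q - X w) z) by exact: growth_integrable gX.
  under eq_fun do rewrite dotBl; apply: growthB; last exact: growth_dot.
  exact: growth_weaken (growth_cst _ _).
have idir := integrable_direction P mX q z.
have irdir : P.-integrable setT
    (EFin \o (fun w => r * (dot (q - X w) z / enorm (q - X w)))).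
  exact: (integrableZl measurableT r idir).
have bound w :
    `|dot (q - X w) z - r * (dot (q - X w) z / enorm (q - X w))| <= g w.
  have [D0|D0] := eqVneq (enorm (q - X w)) 0.
    rewrite (enorm_eq0 D0) dot0l mul0r mulr0 subr0 normr0.
    by apply: le_trans (gle w); rewrite mulr_ge0 ?enorm_ge0.
  rewrite [X in `|X|](_ : _ = dot (q - X w) z / enorm (q - X w) *
      (enorm (q - X w) - r)); last by field.
  rewrite normrM; apply: le_trans (gle w); rewrite ler_wpM2l//.
  apply: le_trans (ler_dist_enorm _ _) _.
  by rewrite addrAC subrr add0r enormN.
have -> : dot (q - mu) z - r * (alpha * dot u z) =
    \int[P]_w (dot (q - X w) z - r * (dot (q - X w) z / enorm (q - X w))).
  rewrite RintegralB// RintegralZl// fo; congr (_ - _).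
  under eq_Rintegral do rewrite dotBl.
  rewrite RintegralB//; last 2 first.
  - exact: finite_measure_integrable_cst.
  - exact: growth_integrable (growth_dot mX z).
  by rewrite Rintegral_cst_prob dotBl (dot_mean mX).
have idiff := integrable_EFinB iX irdir.
apply: le_trans (le_normr_Rintegral _ idiff) _ => //.
apply: le_Rintegral => //.
apply: (integrable_le _ ig) => [|w]; last by rewrite normr_id.
by apply: measurableT_comp => //; apply/measurable_EFinP; case/integrableP: idiff.
Qed.

Lemma radial_le1 z :
  `|dot (q - mu) z - r * (alpha * dot u z)| <= enorm z * m1.
Proof.
rewrite -RintegralZl//; last exact: growth_integrable (growth_enorm mX).
apply: radial_le => [|w].
  exact: growth_integrable (growthZ (enorm z) (growth_enorm mX)).
by rewrite ler_wpM2r ?enorm_ge0 ?direction_le.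
Qed.

Let p := perp u (q - mu).

Let pu : dot p u = 0. Proof. exact: dot_perp. Qed.

Let dot_p : dot (q - mu) p - r * (alpha * dot u p) = enorm p * enorm p.
Proof.
by rewrite (dotC u) pu !mulr0 subr0 -(dot_perpl _ pu) -sqr_enorm expr2.
Qed.

(** Testing against [p], which is orthogonal to [u], removes the term in [alpha] and leaves
    [enorm p ^+ 2 <= enorm p * m1]. *)
Lemma perp_shift_le : enorm p <= m1.
Proof.
have [->//|p0] := eqVneq (enorm p) 0.
have pp : 0 < enorm p by rewrite lt_neqAle eq_sym p0 enorm_ge0.
have := radial_le1 p; rewrite dot_p ger0_norm ?mulr_ge0 ?enorm_ge0//.
by rewrite ler_pM2l.
Qed.

Lemma perp_quantile_le : enorm (perp u q) <= C.
Proof.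
have -> : perp u q = p + perp u mu by rewrite /p perpB subrK.
apply: le_trans (ler_enormD _ _) _; rewrite lerD ?perp_shift_le//.
exact: enorm_perp_le.
Qed.

Lemma radial_component_le : `|dot q u - r * alpha| <= C.
Proof.
have := radial_le1 u; rewrite -sqr_enorm u1 expr1n mulr1 mul1r dotBl => h.
have -> : dot q u - r * alpha = (dot q u - dot mu u - r * alpha) + dot mu u by ring.
apply: le_trans (ler_normD _ _) _; apply: lerD => //.
by apply: le_trans (cauchy_schwarz _ _) _; rewrite u1 mulr1.
Qed.

Hypothesis r0 : 0 < r.

Lemma perp_residual_le w : enorm (perp u (q - X w)) <= C + enorm (X w).
Proof.
rewrite perpB; apply: le_trans (ler_enormB _ _) _.
by rewrite lerD ?perp_quantile_le ?enorm_perp_le.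
Qed.

(** Bootstraps the bound of [perp_shift_le]: only the orthogonal part of [q - X] meets [p], and it
    is at most [C + enorm (X w)]. Dividing by a distance of order [r] gains the factor [1 / r]. *)
Lemma perp_shift_small : enorm p <= K / r.
Proof.
have [->|p0] := eqVneq (enorm p) 0.
  rewrite divr_ge0 ?(ltW r0)//; apply: Rintegral_ge0 => w _.
  by rewrite !mulr_ge0 ?addr_ge0 ?enorm_ge0.
have pp : 0 < enorm p by rewrite lt_neqAle eq_sym p0 enorm_ge0.
rewrite -(ler_pM2l pp) -dot_p; apply: le_trans (ler_norm _) _.
have -> : enorm p * (K / r) = enorm p / r * K by ring.
rewrite -RintegralZl//; last exact: growth_integrable growthK.
apply: radial_le => [|w].
  exact: growth_integrable (growthZ (enorm p / r) growthK).
have s0 := enorm_ge0 (X w); have b0 := enorm_ge0 (perp u (q - X w)).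
have bC := perp_residual_le w; have dirle := direction_le (q - X w) p.
set s := enorm (X w) in s0 bC *; set b := enorm (perp u _) in b0 bC.
have -> : enorm p / r * (2 * ((C + s) * s)) = enorm p * (2 / r * (C + s)) * s by ring.
rewrite ler_wpM2r//.
(* When [s > r / 2] the factor [2 / r * (C + s)] is at least 1 and the trivial bound suffices;
   otherwise the distance from [q] to [X w] is at least [r / 2]. *)
have [sr|rs] := leP s (r / 2); last first.
  apply: le_trans dirle _; rewrite -[leLHS]mulr1 ler_wpM2l ?enorm_ge0//.
  by rewrite mulrAC ler_pdivlMr// mul1r; have := C_ge0; lra.
have Dr : r / 2 <= enorm (q - X w).
  have := ler_enormD (q - X w) (X w); rewrite subrK -/r -/s; lra.
have Dp : 0 < enorm (q - X w) by apply: lt_le_trans Dr; rewrite divr_gt0.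
rewrite -(dot_perpl _ pu) normrM normfV (gtr0_norm Dp) ler_pdivrMr//.
apply: le_trans (cauchy_schwarz _ _) _; rewrite -/b [leLHS]mulrC -[leRHS]mulrA.
rewrite ler_wpM2l ?enorm_ge0//.
have Cs0 : 0 <= C + s by exact: addr_ge0.
apply: le_trans bC _; rewrite mulrAC -[leLHS]mul1r ler_wpM2r//.
by rewrite mulrAC ler_pdivlMr// mul1r; lra.
Qed.

(** Bias-variance decomposition in the hyperplane orthogonal to [u]: [p] is the bias, and the cross
    term has mean 0. *)
Lemma perp_residual_integral :
  \int[P]_w enorm (perp u (q - X w)) ^+ 2 = tau + enorm p ^+ 2.
Proof.
have gY := growth_centered P mX p.
have gp := growth_sqr_perp mX u1 mu.
have -> : \int[P]_w enorm (perp u (q - X w)) ^+ 2 =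
    \int[P]_w (enorm (perp u (X w - mu)) ^+ 2 -
      (2 * dot (X w - mu) p - enorm p ^+ 2)).
  apply: eq_Rintegral => w _.
  have -> : perp u (q - X w) = p + - perp u (X w - mu).
    by rewrite -perpB opprB addrA subrK.
  by rewrite sqr_enormD enormN dotNr dotC (dot_perpl _ pu); ring.
have i1 : P.-integrable setT (EFin \o (fun w => 2 * dot (X w - mu) p)).
  exact: growth_integrable (growthZ 2 gY).
have ic : P.-integrable setT (EFin \o (fun=> enorm p ^+ 2)).
  exact: finite_measure_integrable_cst.
rewrite RintegralB//; last 2 first.
- exact: growth_integrable gp.
- exact: integrable_EFinB.
rewrite RintegralB// RintegralZl//; last exact: growth_integrable gY.
by rewrite (Rintegral_centered mX moment3) Rintegral_cst_prob mulr0 sub0r opprK.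
Qed.

Lemma remainder_integral :
  \int[P]_w remainder r (enorm (q - X w)) (dot (q - X w) u) =
  r * (r ^+ 2 * (1 - alpha) - 2^-1 * tau) - r / 2 * enorm p ^+ 2.
Proof.
have gq : growth X 2 (fun w => enorm (perp u (q - X w)) ^+ 2).
  have := growth_sqr_perp mX u1 q; congr (growth X 2 _).
  by apply/funext => w; rewrite -(opprB q) /perp dotNl scaleNr -opprD enormN.
rewrite /remainder.
under eq_Rintegral do rewrite -(sqr_enorm_perp _ u1).
have idir := integrable_direction P mX q u.
have ic : P.-integrable setT (EFin \o (fun=> (1 : R))).
  exact: finite_measure_integrable_cst.
have i1 := integrable_EFinB ic idir.
have iq : P.-integrable setT (EFin \o (fun w => enorm (perp u (q - X w)) ^+ 2)).
  exact: growth_integrable gq.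
rewrite RintegralB//; last 2 first.
- exact: (integrableZl measurableT (r ^+ 3) i1).
- exact: (integrableZl measurableT (r / 2) iq).
rewrite !RintegralZl// RintegralB// Rintegral_cst_prob fo perp_residual_integral.
by rewrite -sqr_enorm u1; field.
Qed.

Lemma measurable_remainder :
  measurable_fun setT
    (fun w => remainder r (enorm (q - X w)) (dot (q - X w) u)).
Proof.
have mqX : random_vector (fun w => q - X w) by exact: random_vectorB.
apply: measurable_funB; apply: measurable_funM => //.
  by apply: measurable_funB => //; exact: measurable_direction.
by apply: measurable_funB; apply: measurable_funX;
  [exact: measurable_enorm|exact: measurable_dotl].
Qed.

Lemma remainder_dominated w : 3 / 4 <= alpha -> 4 * C <= r ->
  `|remainder r (enorm (q - X w)) (dot (q - X w) u)| <=
  130 * (C + enorm (X w)) ^+ 3.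
Proof.
move=> a34 Cr; apply: (remainder_le (b := enorm (perp u (q - X w)))) => //.
- exact: enorm_ge0.
- exact: enorm_ge0.
- exact: enorm_ge0.
- exact: sqr_enorm_perp.
- apply: le_trans (ler_dist_enorm _ _) _.
  by rewrite addrAC subrr add0r enormN.
- exact: perp_residual_le.
(* The component along [u] is at least [r * alpha - C - s], hence at least
   [3 / 4 * r - r / 4 - r / 4]; this fixes the thresholds [3 / 4] and [4 * C]. *)
- move=> sr; rewrite dotBl.
  have := radial_component_le; rewrite ler_norml => /andP[h _].
  have := dot_le_enorm (X w) u; rewrite u1 mulr1 => h'.
  have : 3 / 4 * r <= r * alpha by rewrite mulrC ler_wpM2l// ltW.
  by lra.
Qed.

End OneQuantile.

Variables (alpha : nat -> R) (q : nat -> 'cV[R]_d).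
Hypothesis fo : forall n z,
  \int[P]_w (dot (q n - X w) z / enorm (q n - X w)) = alpha n * dot u z.
Hypothesis alpha1 : alpha n @[n --> \oo] --> (1 : R).
Hypothesis alpha_ge : forall n, 3 / 4 <= alpha n.
Hypothesis q0 : forall n, 0 < enorm (q n).
Hypothesis q_ge : forall n, 4 * C <= enorm (q n).
Hypothesis qinv : (enorm (q n))^-1 @[n --> \oo] --> (0 : R).

Lemma quantile_expansion :
  enorm (q n) * (enorm (q n) ^+ 2 * (1 - alpha n) - 2^-1 * tau) @[n --> \oo] -->
  \int[P]_w (dot (X w) u * enorm (perp u (X w - mu)) ^+ 2).
Proof.
have cst0 (a : R) : a / enorm (q n) @[n --> \oo] --> (0 : R).
  by rewrite -(mulr0 a); apply: cvgM => //; exact: cvg_cst.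
have qdir : dot (q n) u / enorm (q n) @[n --> \oo] --> (1 : R).
  have h : dot (q n) u / enorm (q n) - alpha n @[n --> \oo] --> (0 : R).
    apply: (squeeze_cvg0 _ (cst0 C)) => n.
    rewrite -[alpha n](mulKf (lt0r_neq0 (q0 n))) mulrC -mulrBr normrM mulrC.
    rewrite normfV (gtr0_norm (q0 n)) ler_pM2r ?invr_gt0//.
    exact: radial_component_le.
  rewrite -[1 : R]add0r; have -> : (fun n => dot (q n) u / enorm (q n)) =
      (fun n => dot (q n) u / enorm (q n) - alpha n + alpha n).
    by apply/funext => n; rewrite subrK.
  exact: cvgD.
have qperp : enorm (perp u (q n - mu)) @[n --> \oo] --> (0 : R).
  apply: (squeeze_cvg0 _ (cst0 K)) => n.
  by rewrite ger0_norm ?enorm_ge0// (perp_shift_small (fo n)).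
(* As [enorm p] is at most [K / r], this correction is at most [K ^+ 2 / 2 / r]. *)
have p2 : enorm (q n) / 2 * enorm (perp u (q n - mu)) ^+ 2 @[n --> \oo] --> (0 : R).
  apply: (squeeze_cvg0 _ (cst0 (K ^+ 2 / 2))) => n.
  have h : enorm (q n) * enorm (perp u (q n - mu)) <= K.
    by rewrite mulrC -ler_pdivlMr// (perp_shift_small (fo n)).
  have h0 := enorm_ge0 (perp u (q n - mu)); have r0 := q0 n.
  rewrite ger0_norm; last by rewrite mulr_ge0 ?sqr_ge0// divr_ge0// ltW.
  rewrite ler_pdivlMr//.
  have -> : enorm (q n) / 2 * enorm (perp u (q n - mu)) ^+ 2 * enorm (q n) =
    (enorm (q n) * enorm (perp u (q n - mu))) ^+ 2 / 2 by ring.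
  rewrite ler_pM2r ?invr_gt0// ler_pXn2r ?nnegrE//.
    by rewrite mulr_ge0// ltW.
  by apply: le_trans h; rewrite mulr_ge0// ltW.
have main : \int[P]_w remainder (enorm (q n)) (enorm (q n - X w))
    (dot (q n - X w) u) @[n --> \oo] -->
    \int[P]_w (dot (X w) u * enorm (perp u (X w - mu)) ^+ 2).
  apply: (Rintegral_cvg_dominated
    (g := fun w => 130 * (C + enorm (X w)) ^+ 3)).
  - by move=> n; exact: measurable_remainder.
  - have [+ _] := growthM (growth_dot mX u) (growth_sqr_perp mX u1 mu).
    by [].
  - have gC : growth X 1 (fun w => C + enorm (X w)).
      apply: growthD; last exact: growth_enorm.
      exact: growth_weaken (growth_cst _ _).
    exact: growth_integrable (growthZ 130 (growthX 3 gC)).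
  - by apply: aeW => w; exact: remainder_cvg.
  - by move=> n w; exact: (remainder_dominated (fo n)).
have -> : (fun n => enorm (q n) * (enorm (q n) ^+ 2 * (1 - alpha n) - 2^-1 * tau))
    = (fun n => \int[P]_w remainder (enorm (q n)) (enorm (q n - X w))
         (dot (q n - X w) u)
       + enorm (q n) / 2 * enorm (perp u (q n - mu)) ^+ 2).
  by apply/funext => n; rewrite (remainder_integral (fo n)) subrK.
rewrite -[\int[P]_w (dot (X w) u * _)]addr0; exact: cvgD.
Qed.

End Expansion.

(** * The limit as the index tends to the unit sphere *)

Theorem theorem4p1 (R : realType) (disp : measure_display)
    (T : measurableType disp) (P : probability T R)
    (d : nat) (hd : (2 <= d)%N)
    (u : 'cV[R]_d) (hu : enorm u = 1)
    (X : T -> 'cV[R]_d) (hX : random_vector X)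
    (hatom : atomless P X) (hline : ~ on_a_line P X)
    (hmoment : ('E_P[fun w => (enorm (X w) ^+ 3)%R] < +oo)%E) :
  let mu := mean_vector P X in
  let Sigma := covariance_matrix P X in
  let q (alpha : R) := geometric_quantile P X (alpha *: u) in
  enorm (q alpha) *
    (enorm (q alpha) ^+ 2 * (1 - alpha)
       - 2^-1 * (\tr Sigma - dot (Sigma *m u) u))
    @[alpha --> 1^'-] -->
  fine 'E_P[fun w => dot (X w) u * enorm (X w - dot (X w) u *: u) ^+ 2]
    - dot ((2 *: Sigma + mu *m mu^T) *m u) ((1%:M - u *m u^T) *m mu).
Proof.
move=> mu Sigma q.
have moment3 : P.-integrable setT (EFin \o (fun w => enorm (X w) ^+ 3)).
  apply/integrableP; split.
    by apply/measurable_EFinP; apply: measurable_funX; exact: measurable_enorm.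
  move: hmoment; rewrite unlock; congr (_ < _)%E; apply: eq_integral => w _ /=.
  by rewrite ger0_norm// exprn_ge0// enorm_ge0.
have intX : P.-integrable setT (EFin \o (fun w => enorm (X w))).
  exact: growth_integrable (growth_enorm hX).
have -> : (1%:M - u *m u^T) *m mu = perp u mu.
  rewrite mulmxBl mul1mx -mulmxA; congr (_ - _); apply/colP => i.
  rewrite !mxE big_ord1 [LHS]mulrC !mxE; congr (_ * _).
  by apply: eq_bigr => j _; rewrite mxE mulrC.
rewrite fine_expectation (third_moment_perp hX moment3 hu).
rewrite (covariance_perp hX moment3 hu).
(* Passing to sequences makes sequential dominated convergence applicable. *)
apply/cvg_at_leftP => alpha [alt1 alpha1].
set C := \int[P]_w enorm (X w) + enorm mu.
have C0 : 0 <= C.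
  by rewrite addr_ge0 ?enorm_ge0//; apply: Rintegral_ge0 => w _; exact: enorm_ge0.
have a34 : \forall n \near \oo, 3 / 4 <= alpha n.
  by apply: (cvgr_ge _ alpha1); lra.
(* Existence of a minimiser ensures that [geometric_quantile] is one, not the default 0. The bound
   [3 / 4] gives [alpha n] a sign, so that its absolute value is below 1. *)
have qmin : \forall n \near \oo, is_geometric_quantile P X (alpha n *: u) (q (alpha n)).
  apply: filterS a34 => n an.
  have [|q' hq'] := @quantile_exists _ _ _ P _ X hX intX (alpha n *: u).
    by rewrite enormZ hu mulr1 ger0_norm//; lra.
  exact: (xgetPex 0 (ex_intro _ q' hq')).
have qbig (M : R) : 0 <= M -> \forall n \near \oo, M < enorm (q (alpha n)).
  move=> M0; have [e e0 he] := quantile_unbounded hX hatom hline hu M0.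
  have ae : \forall n \near \oo, 1 - e < alpha n.
    by apply: (cvgr_gt _ alpha1); lra.
  apply: filterS2 ae qmin => n an; apply: he.
  by rewrite an alt1.
have [N _ HN] : \forall n \near \oo, [/\ 3 / 4 <= alpha n,
    is_geometric_quantile P X (alpha n *: u) (q (alpha n)) &
    4 * C < enorm (q (alpha n))].
  by apply: filterS3 a34 qmin (qbig (4 * C) (mulr_ge0 _ C0)).
(* Dropping the first [N] terms makes the eventual bounds hold at every index, as
   [quantile_expansion] requires. *)
have {}HN n := HN (n + N)%N (leq_addl n N).
rewrite -(cvg_shiftn N).
have q0 n : 0 < enorm (q (alpha (n + N)%N)).
  by have [_ _] := HN n; apply: le_lt_trans; rewrite mulr_ge0.
apply: (@quantile_expansion _ _ _ P _ X hX moment3 u hu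
  (fun n => alpha (n + N)%N) (fun n => q (alpha (n + N)%N))) => //.
- move=> n z; have [_ qm _] := HN n.
  by rewrite (quantile_first_order hX hatom z qm) dotZl.
- by rewrite (cvg_shiftn N alpha).
- by move=> n; have [] := HN n.
- by move=> n; have [_ _ /ltW] := HN n.
- rewrite (cvg_shiftn N (fun n => (enorm (q (alpha n)))^-1)).
  apply/cvgr0Pnorm_lt => e e0.
  have e1 : 0 < e^-1 by rewrite invr_gt0.
  apply: filterS (qbig e^-1 (ltW e1)) => n qe.
  have q0' : 0 < enorm (q (alpha n)) by exact: lt_trans qe.
  by rewrite normfV gtr0_norm// invf_plt.
Qed.
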